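(* No infinite-dimensional closed subspace of $c_0$ satisfies Lindenstrauss property A.
   Context: Banach spaces are over $\mathbb{R}$ or $\mathbb{C}$ (the same field for all spaces involved). For Banach spaces $X,Z$, $L(X,Z)$ is the space of bounded linear operators from $X$ into $Z$ with the operator norm, and $NA(X,Z)$ is the set of those $T\in L(X,Z)$ attaining their norm, i.e. such that $\|T\|=\|Tx\|$ for some $x\in X$ with $\|x\|=1$. A Banach space $X$ has Lindenstrauss property A if $NA(X,Z)$ is dense in $L(X,Z)$ for every Banach space $Z$. The space $c_0$ is the space of scalar null sequences with the supremum norm. *)

(* Defs.v *)
From HB Require Import structures.
From mathcomp Require Import all_boot all_order all_algebra.
From mathcomp Require Import all_classical all_reals all_analysis.
From mathcomp Require Import complex.

Set Implicit Arguments.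
Unset Strict Implicit.
Unset Printing Implicit Defensive.

Import Order.TTheory GRing.Theory Num.Theory.
Import numFieldNormedType.Exports.

Local Open Scope classical_set_scope.
Local Open Scope ring_scope.

Variant real_or_complex (R : realType) : numFieldType -> Prop :=
| RealScalars : real_or_complex R R
| ComplexScalars : real_or_complex R R[i].

Section c0_carrier.
Variable K : numFieldType.

Definition null_seq : {pred nat -> K} :=
  [pred x : nat -> K | `[< x @ \oo --> (0 : K) >]].

Lemma null_seqP (x : nat -> K) : reflect (x @ \oo --> (0 : K)) (x \in null_seq).
Proof. exact: asboolP. Qed.

Lemma null_seq_submod_closed : submod_closed null_seq.
Proof.
split; first by apply/null_seqP; exact: cvg_cst.
move=> a x y /null_seqP x0 /null_seqP y0; apply/null_seqP.
rewrite -[X in _ --> X](addr0 (0 : K)) -{1}(mulr0 a).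
by apply: cvgD => //; exact: cvgMl_tmp.
Qed.

HB.instance Definition _ :=
  GRing.isSubmodClosed.Build K (nat -> K) null_seq null_seq_submod_closed.

Definition c0 : Type := {x : nat -> K | x \in null_seq}.

HB.instance Definition _ := SubChoice.on c0.
HB.instance Definition _ := [SubChoice_isSubLmodule of c0 by <:].

End c0_carrier.

Section c0_norm.
Variable K : numFieldType.
Implicit Types x y : c0 K.

(* K-valued, like all norms of the library: for K = R[i] the values are
   nonnegative reals for the partial order of R[i]. *)
Definition c0_norm x : K := supremum 0 [set `|val x n| | n in [set: nat]].

Lemma c0_norm_attained x :
  exists2 m, c0_norm x = `|val x m| & forall n, `|val x n| <= `|val x m|.
Proof.
suff [m mP] : exists m, forall n, `|val x n| <= `|val x m|.
  exists m => //; rewrite /c0_norm /supremum ifF; last first.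
    apply/negbTE/set0P; by exists `|val x m|, m.
  have sm : supremums [set `|val x n| | n in [set: nat]] `|val x m|.
    by split=> [_ [n _ <-]|b]; [exact: mP|apply; exists m].
  by case: xgetP => [y _ ys|/(_ _ sm)//]; apply: is_subset1_supremums ys sm.
have maxP N : exists m, forall n, (n <= N)%N -> `|val x n| <= `|val x m|.
  elim: N => [|N [m mP]]; first by exists 0%N => n; rewrite leqn0 => /eqP ->.
  have [le|/ltW le] := real_leP (normr_real (val x N.+1)) (normr_real (val x m)).
    by exists m => n; rewrite leq_eqVlt => /orP[/eqP ->//|]; exact: mP.
  exists N.+1 => n; rewrite leq_eqVlt => /orP[/eqP ->//|/mP nm].
  exact: le_trans nm le.
have [[k xk]|/forallNP x0] := pselect (exists k, val x k != 0); last first.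
  by exists 0%N => n; move/negP: (x0 n); rewrite negbK => /eqP ->; rewrite normr0.
have /null_seqP/cvgr0Pnorm_lt/(_ `|val x k|) := valP x.
rewrite normr_gt0 => /(_ xk)[N _ NP].
have [m mP] := maxP (maxn N k); exists m => n.
have [nN|/ltnW Nn] := leqP n (maxn N k); first exact: mP.
apply: le_trans (mP k (leq_maxr _ _)).
by apply/ltW/NP => /=; apply: leq_trans Nn; exact: leq_maxl.
Qed.

Lemma c0_norm_ge x n : `|val x n| <= c0_norm x.
Proof. by have [m ->] := c0_norm_attained x. Qed.

Lemma c0_normD x y : c0_norm (x + y) <= c0_norm x + c0_norm y.
Proof.
have [m -> _] := c0_norm_attained (x + y).
rewrite raddfD; apply: le_trans (ler_normD _ _) _.
by apply: lerD; exact: c0_norm_ge.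
Qed.

Lemma c0_normZ (a : K) x : c0_norm (a *: x) = `|a| * c0_norm x.
Proof.
have [m mE mP] := c0_norm_attained x; have [k kE kP] := c0_norm_attained (a *: x).
apply/le_anti/andP; split.
  by rewrite kE linearZ normrM ler_wpM2l// c0_norm_ge.
rewrite mE -normrM; have := c0_norm_ge (a *: x) m.
by rewrite linearZ.
Qed.

Lemma c0_norm_eq0 x : c0_norm x = 0 -> x = 0.
Proof.
move=> x0; apply: val_inj; rewrite raddf0; apply/funext => n.
by apply/normr0_eq0/le_anti; rewrite normr_ge0 -[X in _ <= X]x0 c0_norm_ge.
Qed.

HB.instance Definition _ :=
  Lmodule_isNormed.Build K (c0 K) c0_normD c0_normZ c0_norm_eq0.

End c0_norm.

Section subspace_norm.
Variables (K : numFieldType) (E : normedModType K) (V : submodClosed E).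

Definition normed_subspace : Type := {x : E | x \in V}.

HB.instance Definition _ := SubChoice.on normed_subspace.
HB.instance Definition _ := [SubChoice_isSubLmodule of normed_subspace by <:].

Implicit Types x y : normed_subspace.

Definition subspace_norm x : K := `|val x|.

Lemma subspace_normD x y :
  subspace_norm (x + y) <= subspace_norm x + subspace_norm y.
Proof. by rewrite /subspace_norm raddfD ler_normD. Qed.

Lemma subspace_normZ (a : K) x : subspace_norm (a *: x) = `|a| * subspace_norm x.
Proof. by rewrite /subspace_norm linearZ normrZ. Qed.

Lemma subspace_norm_eq0 x : subspace_norm x = 0 -> x = 0.
Proof. by move=> /normr0_eq0 x0; apply: val_inj; rewrite raddf0. Qed.

HB.instance Definition _ := Lmodule_isNormed.Build K normed_subspace
  subspace_normD subspace_normZ subspace_norm_eq0.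

End subspace_norm.

Definition infinite_dimensional (K : numFieldType) (E : lmodType K) : Prop :=
  ~ exists (n : nat) (e : 'I_n -> E),
      forall x : E, exists c : 'I_n -> K, x = \sum_(i < n) c i *: e i.

Section operators.
Variables (K : numFieldType) (X Z : normedModType K).

Definition bounded_operator (T : X -> Z) : Prop :=
  exists M : K, forall x, `|T x| <= M * `|x|.

(* The default value 0 of supremum is irrelevant for bounded operators when K is
   R or R[i]. Taking the closed unit ball rather than the unit sphere gives norm
   0 when X is the zero space. *)
Definition operator_norm (T : X -> Z) : K :=
  supremum 0 [set `|T x| | x in [set x | `|x| <= 1]].

Definition norm_attaining (T : X -> Z) : Prop :=
  exists2 x : X, `|x| = 1 & operator_norm T = `|T x|.

End operators.

(* Density of NA(X, Z) in L(X, Z) is with respect to the operator norm.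
   Completeness of X plays no role in the property, so it is not required here;
   a closed subspace of c0 over R or R[i] is complete anyway. *)
Definition lindenstrauss_A (K : numFieldType) (X : normedModType K) : Prop :=
  forall (Z : completeNormedModType K) (T : {linear X -> Z}),
    bounded_operator T ->
    forall eps : K, 0 < eps ->
      exists S : {linear X -> Z},
        [/\ bounded_operator S, norm_attaining S & operator_norm (T \- S) < eps].

(* Main.v *)
(** Lindenstrauss' argument: renorm c0 by the strictly convex equivalent norm
    day_norm x = (|x|^2 + \sum_n (2^-(n+1) |x_n|)^2)^(1/2), and let T be the
    inclusion of V into the renormed space.  If S attains its norm at x0 and is
    close to T, then S is injective.  But no point of the unit ball of V is
    extreme: all but finitely many coordinates of x0 are at most 1/2 in modulus
    and V is infinite-dimensional, so some y <> 0 in V has |x0 + y| <= 1 and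
    |x0 - y| <= 1.  Strict convexity then forces S y = 0, a contradiction. *)
Require Import Defs.
From HB Require Import structures.
From mathcomp Require Import all_boot all_order all_algebra.
From mathcomp Require Import all_classical all_reals all_analysis.
From mathcomp Require Import complex.
From mathcomp Require Import ring lra.

Set Implicit Arguments.
Unset Strict Implicit.
Unset Printing Implicit Defensive.

Import Order.TTheory GRing.Theory Num.Theory.
Import numFieldNormedType.Exports.

Local Open Scope classical_set_scope.
Local Open Scope ring_scope.

(** * Real and complex scalars *)

Definition norm_complete (K : numFieldType) : Prop :=
  forall F : set_system K, ProperFilter F ->
    (forall e, 0 < e -> exists x, \forall y \near F, `|x - y| < e) ->
    exists l, forall e, 0 < e -> \forall y \near F, `|l - y| <= e.

(* What the proof uses of the scalars, with the two cases of [real_or_complex]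
   as instances.  Norms are [K]-valued, and [emb], [modulus] transfer them to
   [R], where square roots and suprema exist. *)
Record scalar_field (R : realType) (K : numFieldType) := ScalarField {
  emb : {rmorphism R -> K};
  modulus : K -> R;
  ler_emb : {mono emb : x y / x <= y};
  emb_modulus : forall x, emb (modulus x) = `|x|;
  parallelogram : forall x y : K,
    `|x + y| ^+ 2 + `|x - y| ^+ 2 = (`|x| ^+ 2 + `|y| ^+ 2) *+ 2;
  scalar_complete : norm_complete K }.

Arguments emb {R K} _.
Arguments modulus {R K} _.

Section instances.
Variable R : realType.

Lemma real_complete : norm_complete R.
Proof.
move=> F FF cF.
have /cauchy_cvg : cauchy (F : set_system (R : completeType)).
  apply/cauchy_exP => e e0; have [x xP] := cF e e0.
  by exists x; rewrite -ball_normE.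
move=> /cvg_ex[l /cvgrPdist_le lP]; exists l => e e0; exact: lP.
Qed.

(** The real and imaginary parts are 1-Lipschitz, so they carry a Cauchy filter to Cauchy filters on
    [R], whose two limits form the complex limit. *)
Lemma complex_complete : norm_complete R[i].
Proof.
move=> F FF cF.
have comp (p : R[i] -> R) : (forall x y, `|p x - p y|%:C%C <= `|x - y|) ->
    exists l, forall e, 0 < e -> \forall y \near F, `|l - p y| <= e.
  move=> ple; have [|l lP] := @real_complete (p @ F) _.
    move=> e e0; have [|x xP] := cF e%:C%C; first by rewrite ltcR.
    exists (p x); apply: filterS xP => y xy /=.
    by rewrite -ltcR; apply: le_lt_trans xy.
  by exists l.
have [x y|a aP] := comp (@complex.Re R).
  by have := normc_ge_Re (x - y); rewrite raddfB.
have [x y|b bP] := comp (@complex.Im R).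
  by rewrite normc_def lecR -raddfB -sqrtr_sqr ler_wsqrtr// lerDr sqr_ge0.
exists (a +i* b)%C => e e0.
(* A positive element of [R[i]] is real, so [e] can be halved in [R]; two coordinates within [e']
   give a distance of at most [e' + e']. *)
have [e' e'0 ee'] : exists2 e' : R, 0 < e' & (e' + e')%:C%C = e.
  have er : e \is Num.real by exact: gtr0_real.
  exists (complex.Re e / 2).
    by rewrite divr_gt0// -ltcR RRe_real.
  by rewrite -splitr RRe_real.
apply: filterS2 (aP e' e'0) (bP e' e'0) => -[u v] /= au bv.
rewrite -ee' normc_def/= lecR.
rewrite -(@ger0_norm _ (e' + e')); last by rewrite ltW ?addr_gt0.
rewrite -sqrtr_sqr ler_wsqrtr//.
rewrite -[_ ^+ 2]real_normK ?num_real// -[X in _ + X]real_normK ?num_real//.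
have := normr_ge0 (a - u); have := normr_ge0 (b - v); nra.
Qed.

Lemma real_parallelogram (x y : R) :
  `|x + y| ^+ 2 + `|x - y| ^+ 2 = (`|x| ^+ 2 + `|y| ^+ 2) *+ 2.
Proof. rewrite !real_normK ?num_real//; ring. Qed.

Lemma complex_parallelogram (x y : R[i]) :
  `|x + y| ^+ 2 + `|x - y| ^+ 2 = (`|x| ^+ 2 + `|y| ^+ 2) *+ 2.
Proof.
rewrite -!add_Re2_Im2 -!(rmorphD (real_complex R)) -(rmorphMn (real_complex R)).
by congr (real_complex R _); case: x y => [a b] [c d] /=; ring.
Qed.

Definition real_scalars : scalar_field R R :=
  @ScalarField R R idfun Num.norm (fun _ _ => erefl) (fun _ => erefl)
    real_parallelogram real_complete.

Lemma Re_norm_complex (x : R[i]) : real_complex R (complex.Re `|x|) = `|x|.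
Proof. by rewrite RRe_real ?normr_real. Qed.

Definition complex_scalars : scalar_field R R[i] :=
  @ScalarField R R[i] (real_complex R) (fun x => complex.Re `|x|)
    (@lecR R) Re_norm_complex complex_parallelogram complex_complete.

End instances.

Section modulus_theory.
Variables (R : realType) (K : numFieldType) (k : scalar_field R K).
Implicit Types x y : K.
Local Notation m := (modulus k).

Lemma emb_inj : injective (emb k).
Proof. exact: inc_inj (@ler_emb _ _ k). Qed.

Lemma ler_modulus x y : (m x <= m y) = (`|x| <= `|y|).
Proof. by rewrite -!(emb_modulus k) ler_emb. Qed.

Lemma modulus_ge0 x : 0 <= m x.
Proof. by rewrite -(ler_emb k) rmorph0 emb_modulus normr_ge0. Qed.

Lemma modulus_eq0 x : (m x == 0) = (x == 0).
Proof. by rewrite -(inj_eq emb_inj) rmorph0 emb_modulus normr_eq0. Qed.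

Lemma modulusM x y : m (x * y) = m x * m y.
Proof. by apply: emb_inj; rewrite rmorphM !emb_modulus normrM. Qed.

Lemma modulus_norm x : m `|x| = m x.
Proof. by apply: emb_inj; rewrite !emb_modulus normr_id. Qed.

Lemma modulusD x y : m (x + y) <= m x + m y.
Proof. by rewrite -(ler_emb k) rmorphD !emb_modulus ler_normD. Qed.

Lemma modulus_parallelogram x y :
  m (x + y) ^+ 2 + m (x - y) ^+ 2 = (m x ^+ 2 + m y ^+ 2) *+ 2.
Proof.
apply: emb_inj; rewrite rmorphMn !rmorphD !rmorphXn/= !emb_modulus.
exact: (parallelogram k).
Qed.

Lemma emb_modulus_ge0 x : 0 <= x -> emb k (m x) = x.
Proof. by move=> x0; rewrite emb_modulus ger0_norm. Qed.

End modulus_theory.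

(** * A strictly convex norm on c0 *)

(** Squaring reduces this triangle inequality of the plane to Cauchy-Schwarz, which comes from
    [0 <= (a * d - b * c) ^+ 2]. *)
Lemma sqrt_minkowski (R : rcfType) (a b c d : R) :
  Num.sqrt ((a + c) ^+ 2 + (b + d) ^+ 2) <=
    Num.sqrt (a ^+ 2 + b ^+ 2) + Num.sqrt (c ^+ 2 + d ^+ 2).
Proof.
set s := Num.sqrt (a ^+ 2 + b ^+ 2); set t := Num.sqrt (c ^+ 2 + d ^+ 2).
have s0 : 0 <= s by exact: sqrtr_ge0.
have t0 : 0 <= t by exact: sqrtr_ge0.
have s2 : s ^+ 2 = a ^+ 2 + b ^+ 2 by rewrite sqr_sqrtr ?addr_ge0 ?sqr_ge0.
have t2 : t ^+ 2 = c ^+ 2 + d ^+ 2 by rewrite sqr_sqrtr ?addr_ge0 ?sqr_ge0.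
rewrite -[leRHS]ger0_norm ?addr_ge0// -sqrtr_sqr ler_wsqrtr//.
suff : a * c + b * d <= s * t by nra.
rewrite (le_trans (ler_norm _))//.
rewrite -[leRHS]ger0_norm ?mulr_ge0// -ler_sqr ?nnegrE ?normr_ge0//.
rewrite !real_normK ?num_real// exprMn s2 t2.
by have := sqr_ge0 (a * d - b * c); nra.
Qed.

Section day_norm.
Variables (R : realType) (K : numFieldType) (k : scalar_field R K).
Implicit Types (x y z : c0 K) (n N : nat).
Local Notation m := (modulus k).

Definition day_weight n x : R := 2^-1 ^+ n.+1 * m (val x n).

Definition day_partial x N : R :=
  Num.sqrt (m (c0_norm x) ^+ 2 + \sum_(n < N) day_weight n x ^+ 2).

(* The partial norms increase with [N], so this is their limit. *)
Definition day_norm x : R := sup (range (day_partial x)).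

Lemma c0_norm_ge0 x : 0 <= c0_norm x.
Proof. by have [i -> _] := c0_norm_attained x. Qed.

Lemma day_weight_ge0 n x : 0 <= day_weight n x.
Proof. by rewrite mulr_ge0 ?exprn_ge0 ?invr_ge0 ?modulus_ge0. Qed.

Lemma sqr_day_partial x N : day_partial x N ^+ 2 =
  m (c0_norm x) ^+ 2 + \sum_(n < N) day_weight n x ^+ 2.
Proof.
by rewrite sqr_sqrtr ?addr_ge0 ?sqr_ge0 ?sumr_ge0// => n _; exact: sqr_ge0.
Qed.

Lemma day_partial_ge0 x N : 0 <= day_partial x N.
Proof. exact: sqrtr_ge0. Qed.

Lemma day_partial0 x : day_partial x 0 = m (c0_norm x).
Proof.
by rewrite /day_partial big_ord0 addr0 sqrtr_sqr ger0_norm ?modulus_ge0.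
Qed.

Lemma day_partialS x N : day_partial x N.+1 =
  Num.sqrt (day_partial x N ^+ 2 + day_weight N x ^+ 2).
Proof. by rewrite sqr_day_partial /day_partial big_ord_recr addrA. Qed.

Lemma day_partial_homo x : {homo day_partial x : M N / (M <= N)%N >-> M <= N}.
Proof.
apply: homo_leq => [//|? ? ?|N]; first exact: le_trans.
rewrite day_partialS -[leLHS]ger0_norm ?day_partial_ge0// -sqrtr_sqr.
by rewrite ler_wsqrtr// lerDl sqr_ge0.
Qed.

Lemma day_weight_le n x : day_weight n x <= 2^-1 ^+ n.+1 * m (c0_norm x).
Proof.
rewrite ler_wpM2l ?exprn_ge0 ?invr_ge0// ler_modulus.
by rewrite (ger0_norm (c0_norm_ge0 x)) c0_norm_ge.
Qed.

Lemma day_partial_le x N : day_partial x N <= m (c0_norm x) *+ 2.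
Proof.
set M := m _; have M0 : 0 <= M by exact: modulus_ge0.
(* The subtracted term makes the induction close: passing to [N.+1] frees three quarters of it, and
   the new squared weight takes at most one quarter. *)
have sqr_le : day_partial x N ^+ 2 <= (2 - (2^-1 ^+ N) ^+ 2) * M ^+ 2.
  elim: N => [|N IH]; first by rewrite day_partial0 expr0 -/M; nra.
  rewrite sqr_day_partial big_ord_recr/= addrA -sqr_day_partial.
  have := day_weight_le N x; have := day_weight_ge0 N x.
  rewrite -/M exprS; move: (2^-1 ^+ N) IH => h.
  set w := day_weight N x; move=> IH w0 wh.
  have : w ^+ 2 <= (2^-1 * h * M) ^+ 2 by rewrite ler_sqr ?nnegrE// (le_trans w0).
  have := sqr_ge0 (h * M).
  rewrite !exprMn; nra.
rewrite -ler_sqr ?nnegrE ?day_partial_ge0 ?mulrn_wge0//.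
apply: le_trans sqr_le _; have := sqr_ge0 (2^-1 ^+ N * M); nra.
Qed.

Lemma day_partial_le_norm x N : day_partial x N <= day_norm x.
Proof.
apply: ub_le_sup; last by exists N.
by exists (m (c0_norm x) *+ 2) => _ [n _ <-]; exact: day_partial_le.
Qed.

Lemma day_norm_le x c : (forall N, day_partial x N <= c) -> day_norm x <= c.
Proof.
by move=> xc; apply: ge_sup => [|_ [N _ <-]//]; exists (day_partial x 0), 0%N.
Qed.

Lemma c0_norm_le_day x : m (c0_norm x) <= day_norm x.
Proof. by rewrite -day_partial0; exact: day_partial_le_norm. Qed.

Lemma day_norm_le_c0 x : day_norm x <= m (c0_norm x) *+ 2.
Proof. by apply: day_norm_le => N; exact: day_partial_le. Qed.

Lemma day_norm_ge0 x : 0 <= day_norm x.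
Proof. exact: le_trans (modulus_ge0 k _) (c0_norm_le_day x). Qed.

(** By [day_partialS], each new weight acts as the second coordinate of a plane vector, so the
    triangle inequality of the plane carries the induction. *)
Lemma day_partialD x y N :
  day_partial (x + y) N <= day_partial x N + day_partial y N.
Proof.
elim: N => [|N IH].
  rewrite !day_partial0; apply: le_trans _ (modulusD _ _ _).
  rewrite ler_modulus !ger0_norm ?addr_ge0 ?c0_norm_ge0//.
  exact: c0_normD.
rewrite !day_partialS; apply: le_trans _ (sqrt_minkowski _ _ _ _).
rewrite ler_wsqrtr// lerD// ler_sqr ?nnegrE ?addr_ge0 ?day_partial_ge0
  ?day_weight_ge0//.
by rewrite -mulrDr ler_wpM2l ?exprn_ge0 ?invr_ge0// raddfD modulusD.
Qed.

Lemma day_normD x y : day_norm (x + y) <= day_norm x + day_norm y.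
Proof.
apply: day_norm_le => N; apply: le_trans (day_partialD _ _ _) _.
by rewrite lerD// day_partial_le_norm.
Qed.

Lemma day_partialZ (a : K) x N : day_partial (a *: x) N = m a * day_partial x N.
Proof.
rewrite /day_partial c0_normZ modulusM modulus_norm.
rewrite -[X in _ = X * _]ger0_norm ?modulus_ge0// -sqrtr_sqr -sqrtrM ?sqr_ge0//.
rewrite mulrDr mulr_sumr exprMn; congr (Num.sqrt (_ + _)).
apply: eq_bigr => n _; rewrite -exprMn /day_weight linearZ/= modulusM.
by rewrite mulrCA.
Qed.

Lemma day_normZ (a : K) x : day_norm (a *: x) = m a * day_norm x.
Proof.
(* Applied to [a^-1] and [a *: x], this inequality also gives the reverse one. *)
have le b y : day_norm (b *: y) <= m b * day_norm y.
  apply: day_norm_le => N; rewrite day_partialZ ler_wpM2l ?modulus_ge0//.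
  exact: day_partial_le_norm.
apply/le_anti; rewrite le/=.
have [->|a0] := eqVneq a 0.
  have /eqP -> : m 0 == 0 by rewrite modulus_eq0.
  by rewrite mul0r day_norm_ge0.
have ma0 : 0 < m a by rewrite lt_neqAle eq_sym modulus_eq0 a0 modulus_ge0.
rewrite -ler_pdivlMl//; have := le a^-1 (a *: x).
rewrite scalerA mulVf// scale1r => /le_trans; apply.
suff -> : m a^-1 = (m a)^-1 by [].
apply: (mulfI (lt0r_neq0 ma0)); rewrite -modulusM divff// divff ?gt_eqF//.
by apply: (@emb_inj _ _ k); rewrite emb_modulus normr1 rmorph1.
Qed.

(* The parallelogram law in each coordinate keeps the weight of [w] as a gap,
   uniformly in the number of terms. *)
Lemma day_norm_extreme z w : day_norm (z + w) <= day_norm z ->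
  day_norm (z - w) <= day_norm z -> w = 0.
Proof.
move=> zw1 zw2; apply: val_inj; rewrite raddf0; apply/funext => n.
apply/eqP; apply: contraT => wn; rewrite /= in wn.
set d := day_weight n w.
have d0 : 0 < d.
  rewrite mulr_gt0 ?exprn_gt0 ?invr_gt0//.
  by rewrite lt_neqAle eq_sym modulus_eq0 wn modulus_ge0.
have gap N : (n < N)%N -> day_partial z N ^+ 2 + d ^+ 2 <= day_norm z ^+ 2.
  move=> nN.
  have up v : day_norm v <= day_norm z ->
      day_partial v N ^+ 2 <= day_norm z ^+ 2.
    move=> vz; rewrite ler_sqr ?nnegrE ?day_partial_ge0 ?day_norm_ge0//.
    exact: le_trans (day_partial_le_norm v N) vz.
  have := up _ zw1; have := up _ zw2; rewrite !sqr_day_partial.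
  have : d ^+ 2 <= \sum_(i < N) day_weight i w ^+ 2.
    by rewrite (bigD1 (Ordinal nN))//= lerDl sumr_ge0// => i _; exact: sqr_ge0.
  have : \sum_(i < N) day_weight i (z + w) ^+ 2 +
         \sum_(i < N) day_weight i (z - w) ^+ 2 =
         (\sum_(i < N) day_weight i z ^+ 2 +
          \sum_(i < N) day_weight i w ^+ 2) *+ 2.
    rewrite -!big_split -sumrMnl/=; apply: eq_bigr => i _.
    rewrite /day_weight !exprMn -!mulrDr -mulrnAr -modulus_parallelogram.
    by rewrite raddfD raddfB.
  (* The sup norm obeys no parallelogram law; midpoint convexity takes its place and yields
     [a ^+ 2 *+ 2 <= b ^+ 2 + c ^+ 2] below. *)
  have : m (c0_norm z) *+ 2 <= m (c0_norm (z + w)) + m (c0_norm (z - w)).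
    rewrite -(ler_emb k) rmorphMn rmorphD/= !emb_modulus_ge0 ?c0_norm_ge0//.
    have := c0_normD (z + w) (z - w); rewrite addrACA subrr addr0.
    rewrite -mulr2n -scaler_nat c0_normZ normr_nat.
    by rewrite mulr_natl.
  have := modulus_ge0 k (c0_norm z).
  set a := m _; set b := m _; set c := m _; move: (\sum_(i < N) _) => A.
  move: (\sum_(i < N) _) => B; move: (\sum_(i < N) _) => C.
  move: (\sum_(i < N) _) => D; move: (_ ^+ 2) => E.
  move=> a0 abc AB ED cz bz.
  have : a ^+ 2 *+ 2 <= b ^+ 2 + c ^+ 2.
    have : (a *+ 2) ^+ 2 <= (b + c) ^+ 2.
      by rewrite ler_sqr ?nnegrE ?(le_trans _ abc) ?mulrn_wge0.
    by have := sqr_ge0 (b - c); nra.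
  by lra.
(* The gap is known for [n < N] only, but the partial norms increase, so it bounds all of them and
   hence their supremum, which is absurd. *)
have : day_norm z <= Num.sqrt (day_norm z ^+ 2 - d ^+ 2).
  apply: day_norm_le => N.
  have := gap (maxn n.+1 N) (leq_maxl _ _); rewrite -lerBrDr.
  move=> /ler_wsqrtr; rewrite sqrtr_sqr ger0_norm ?day_partial_ge0//.
  by apply: le_trans; apply: day_partial_homo; exact: leq_maxr.
rewrite leNgt => /negP[].
have z0 : 0 < day_norm z.
  have := gap n.+1 (leqnn _); have := sqr_ge0 (day_partial z n.+1).
  have := day_norm_ge0 z; nra.
rewrite -[ltRHS]ger0_norm ?ltW// -sqrtr_sqr ltr_sqrt; nra.
Qed.

(** * The renormed c0 as a Banach space *)

(** A copy of [c0 K] keeps the new norm apart from the sup norm; [k] is a parameter because the new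
    norm depends on it. *)
Definition day_space of scalar_field R K : Type := c0 K.
Local Notation Z := (day_space k).
HB.instance Definition _ := GRing.Lmodule.on Z.

Definition day_space_norm (x : Z) : K := emb k (day_norm x).

Lemma day_space_normD (x y : Z) :
  day_space_norm (x + y) <= day_space_norm x + day_space_norm y.
Proof. by rewrite -rmorphD ler_emb; exact: day_normD. Qed.

Lemma day_space_normZ (a : K) (x : Z) :
  day_space_norm (a *: x) = `|a| * day_space_norm x.
Proof. by rewrite /day_space_norm -(emb_modulus k) -rmorphM -day_normZ. Qed.

Lemma c0_norm_le_day_space (x : Z) : c0_norm (x : c0 K) <= day_space_norm x.
Proof.
rewrite -[leLHS](emb_modulus_ge0 k) ?c0_norm_ge0// ler_emb.
exact: c0_norm_le_day.
Qed.

Lemma day_space_norm_le (x : Z) :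
  day_space_norm x <= c0_norm (x : c0 K) *+ 2.
Proof.
rewrite -(@emb_modulus_ge0 _ _ k (c0_norm _)) ?c0_norm_ge0// -rmorphMn ler_emb.
exact: day_norm_le_c0.
Qed.

Lemma day_space_norm_eq0 (x : Z) : day_space_norm x = 0 -> x = 0.
Proof.
move=> x0; apply: (@c0_norm_eq0 K); apply/le_anti.
by rewrite c0_norm_ge0 -x0 c0_norm_le_day_space.
Qed.

HB.instance Definition _ := Lmodule_isNormed.Build K Z
  day_space_normD day_space_normZ day_space_norm_eq0.

(** The new norm dominates the sup norm, so coordinatewise limits exist and are approached
    uniformly. They form a null sequence, and the factor 2 between the norms turns uniform
    convergence into convergence in the new norm. *)
Lemma day_space_cauchy_cvg (F : set_system Z) :
  ProperFilter F -> cauchy F -> cvg F.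
Proof.
move=> FF /cauchyP cF.
have {}cF (e : K) : 0 < e -> exists x : Z,
    \forall y \near F, c0_norm ((x : c0 K) - y) < e.
  move=> /cF[x]; rewrite -ball_normE => xP; exists x.
  by apply: filterS xP => y; apply: le_lt_trans; exact: c0_norm_le_day_space.
have /choice[l lP] n : exists l, forall e : K, 0 < e ->
    \forall y \near F, `|l - val (y : c0 K) n| <= e.
  apply: (@scalar_complete _ _ k ((fun y : Z => val (y : c0 K) n) @ F)).
  move=> e /cF[x xP]; exists (val (x : c0 K) n); apply: filterS xP => y /=.
  by apply: le_lt_trans; have := c0_norm_ge ((x : c0 K) - y) n; rewrite raddfB.
(* One [x] serves all coordinates: for each [n], the comparison with [l n] passes through some [y]
   that may depend on [n]. *)
have unif (e : K) : 0 < e -> exists2 x : Z,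
    \forall y \near F, c0_norm ((x : c0 K) - y) < e &
    forall n, `|l n - val (x : c0 K) n| <= e *+ 2.
  move=> e0; have [x xP] := cF e e0; exists x => // n.
  have [y /= [xy ly]] := filter_ex (filterI xP (lP n e e0)).
  rewrite -(subrKA (val (y : c0 K) n)) (le_trans (ler_normD _ _))// mulr2n lerD//.
  rewrite distrC; apply: le_trans (ltW xy).
  by have := c0_norm_ge ((x : c0 K) - y) n; rewrite raddfB.
have l0 : l \in @null_seq K.
  apply/null_seqP/cvgr0Pnorm_le => e e0.
  have e30 : 0 < e / 3 by rewrite divr_gt0.
  have [x _ lx] := unif _ e30.
  have /null_seqP/cvgr0Pnorm_le/(_ _ e30) := valP (x : c0 K).
  apply: filterS => n xn; rewrite -(subrK (val (x : c0 K) n) (l n)).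
  rewrite (le_trans (ler_normD _ _))// (le_trans (lerD (lx n) xn))//.
  by rewrite -mulrSr -[_ *+ 3]mulr_natr divfK ?pnatr_eq0.
pose L : Z := Sub l l0 : c0 K.
apply/cvg_ex; exists L; apply/cvgrPdist_le => e e0.
(* In each coordinate [l] is within [2e/6] of [x], and [x] within [e/6] of [y]; [day_space_norm_le]
   doubles the total [e/2]. *)
have e60 : 0 < e / 6 by rewrite divr_gt0.
have [x xP lx] := unif _ e60; apply: filterS xP => y xy.
rewrite (le_trans (day_space_norm_le _))//.
have [n -> _] := c0_norm_attained ((L : c0 K) - y).
rewrite raddfB -[X in `|X|]/(l n - val (y : c0 K) n).
rewrite -(subrKA (val (x : c0 K) n)).
have := c0_norm_ge ((x : c0 K) - y) n; rewrite raddfB => xyn.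
have := lerD (lx n) (le_trans xyn (ltW xy)); rewrite -mulrSr.
move=> /(le_trans (ler_normD _ _)); rewrite -(ler_pMn2r (isT : 0 < 2)%N).
move=> /le_trans; apply; rewrite -mulrnA.
by rewrite -[_ *+ _]mulr_natr divfK ?pnatr_eq0.
Qed.

HB.instance Definition _ := Uniform_isComplete.Build Z day_space_cauchy_cvg.

End day_norm.

(** * Operator norms *)

Lemma supremumE d (T : porderType d) (x0 s : T) (A : set T) :
  A !=set0 -> supremums A s -> supremum x0 A = s.
Proof.
move=> /set0P/negbTE A0 As; rewrite /supremum A0.
by case: xgetP => [y _ ys|/(_ s)//]; exact: is_subset1_supremums ys As.
Qed.

Section operator_norm_theory.
Variables (R : realType) (K : numFieldType) (k : scalar_field R K).
Variables (X Z : normedModType K).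

(** The order of [K] may be partial, so the supremum is formed in [R], from the moduli, and carried
    to [K] by [emb]. It is least there because every upper bound in [K] is nonnegative, hence in the
    image of [emb]. *)
Lemma bounded_operator_normP (T : {linear X -> Z}) : bounded_operator T ->
  forall x, `|x| <= 1 -> `|T x| <= operator_norm T.
Proof.
move=> [M TM] x x1.
pose A := [set `|T x| | x in [set x | `|x| <= 1]].
pose B := [set modulus k `|T x| | x in [set x | `|x| <= 1]].
have Ax : A `|T x| by exists x.
have B0 : B !=set0 by exists (modulus k `|T x|), x.
have embB y : emb k (modulus k `|T y|) = `|T y| by rewrite emb_modulus_ge0.
have ubA_emb u : ubound A u -> emb k (modulus k u) = u.
  move=> uA; rewrite emb_modulus_ge0//.
  exact: le_trans (normr_ge0 (T x)) (uA _ Ax).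
have ubA_B u : ubound A u -> ubound B (modulus k u).
  move=> uA _ [y y1 <-]; rewrite -(ler_emb k) embB ubA_emb//.
  by apply: uA; exists y.
(* The sign of [M] is known only once there is a nonzero vector, hence the bound [|M|]. *)
have ubM : ubound A `|M|.
  move=> _ [y y1 <-]; apply: le_trans (TM y) _.
  have [->|y0] := eqVneq y 0; first by rewrite normr0 mulr0.
  have M0 : 0 <= M.
    by rewrite -(@pmulr_lge0 _ `|y|) ?normr_gt0// (le_trans _ (TM y)).
  by rewrite ger0_norm// ler_piMr.
have hB : has_ubound B by exists (modulus k `|M|); exact: ubA_B.
suff As : supremums A (emb k (sup B)).
  rewrite /operator_norm (supremumE _ _ As); last by exists `|T x|.
  by have [+ _] := As; apply.
split=> [_ [y y1 <-]|u uA].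
  by rewrite -embB ler_emb; apply: ub_le_sup => //; exists y.
by rewrite -(ubA_emb u uA) ler_emb; apply: ge_sup => //; exact: ubA_B.
Qed.

Lemma operator_norm_ler (T : {linear X -> Z}) : bounded_operator T ->
  forall x, `|T x| <= operator_norm T * `|x|.
Proof.
move=> Tb x; have [->|x0] := eqVneq x 0; first by rewrite linear0 !normr0 mulr0.
have nx0 : 0 < `|x| by rewrite normr_gt0.
rewrite -ler_pdivrMr// mulrC.
have := bounded_operator_normP Tb (x := `|x|^-1 *: x).
rewrite linearZ !normrZ normfV normr_id mulVf ?normr_eq0//; exact.
Qed.

Lemma bounded_operatorB (S T : {linear X -> Z}) :
  bounded_operator S -> bounded_operator T -> bounded_operator (S \- T).
Proof.
move=> [M SM] [N TN]; exists (M + N) => x /=.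
by rewrite mulrDl (le_trans (ler_normB _ _))// lerD.
Qed.

End operator_norm_theory.

(** * Common zeros of finitely many functionals *)

(** Induction on [N]: if [f N] is nonzero at some common zero [u] of the earlier functionals, [u]
    joins the family, and subtracting the right multiple of it kills [f N] without disturbing the
    others. Otherwise the old family still works. *)
Lemma finite_codimension_kernel (K : fieldType) (E : lmodType K)
    (f : nat -> {scalar E}) (N : nat) :
  exists (n : nat) (e : 'I_n -> E), forall x, exists c : 'I_n -> K,
    forall i, (i < N)%N -> f i (x - \sum_(j < n) c j *: e j) = 0.
Proof.
elim: N => [|N [n [e eP]]].
  by exists 0%N, (fun=> 0) => x; exists (fun=> 0).
have [[u [uN fu]]|no] :=
    pselect (exists u, (forall i, (i < N)%N -> f i u = 0) /\ f N u != 0).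
  exists n.+1, (fun j => oapp e u (unlift ord0 j)) => x.
  have [c cP] := eP x; pose y := x - \sum_(j < n) c j *: e j.
  exists (fun j => oapp c (f N y / f N u) (unlift ord0 j)) => i.
  rewrite big_ord_recl unlift_none/=.
  under eq_bigr do rewrite liftK/=.
  rewrite opprD addrCA addrC -/y.
  rewrite linearB linearZ/=.
  rewrite ltnS leq_eqVlt => /predU1P[->|iN]; first by rewrite mulrVK ?unitfE// subrr.
  by rewrite (uN i)// [f i y]cP// mulr0 subr0.
exists n, e => x; have [c cP] := eP x; exists c => i.
rewrite ltnS leq_eqVlt => /predU1P[->|]; last exact: cP.
apply/eqP; apply: contraT => fN; exfalso; apply: no.
by exists (x - \sum_(j < n) c j *: e j).
Qed.

(** If 0 were the only common zero, every [x] would equal its correction by the finite family [e],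
    which would then span [E]. *)
Lemma infinite_dimensional_common_zero (K : numFieldType) (E : lmodType K)
    (f : nat -> {scalar E}) (N : nat) : infinite_dimensional E ->
  exists2 y, y != 0 & forall i, (i < N)%N -> f i y = 0.
Proof.
move=> infE; apply: contrapT => no; apply: infE.
have [n [e eP]] := finite_codimension_kernel f N.
exists n, e => x; have [c cP] := eP x; exists c.
apply/eqP; rewrite -subr_eq0; apply: contraT => d0; exfalso; apply: no.
by exists (x - \sum_(j < n) c j *: e j).
Qed.

(** * Absence of extreme points in subspaces of c0 *)

Section subspace_of_c0.
Variables (K : numFieldType) (V : submodClosed (c0 K)).

Definition coordinate (n : nat) (x : normed_subspace V) : K := val (val x) n.

Lemma coordinate_is_scalar n : scalar (coordinate n).
Proof. by move=> a x y; rewrite /coordinate !linearP. Qed.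

HB.instance Definition _ n := GRing.isLinear.Build K (normed_subspace V) K _
  (coordinate n) (coordinate_is_scalar n).

Lemma no_extreme_point (x : normed_subspace V) :
  infinite_dimensional (normed_subspace V) -> `|x| <= 1 ->
  exists2 y : normed_subspace V, y != 0 & `|x + y| <= 1 /\ `|x - y| <= 1.
Proof.
move=> Vinf x1.
have /null_seqP/cvgr0Pnorm_le/(_ 2^-1) := valP (val x).
rewrite invr_gt0 ltr0n => /(_ isT)[N _ xN].
have [y y0 yN] :=
  infinite_dimensional_common_zero (fun n => coordinate n : {scalar _}) N Vinf.
(* Scaled to norm 1/2, the perturbation leaves the first [N] coordinates of [x] alone and adds at
   most 1/2 to the others, which are at most 1/2 in modulus. *)
pose z := (2^-1 * `|y|^-1) *: y; exists z.
  by rewrite scaler_eq0 (negbTE y0) orbF mulf_neq0 ?invr_eq0 ?normr_eq0.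
have nz : `|z| = 2^-1.
  rewrite normrZ normrM normfV normr_nat normfV normr_id -mulrA mulVf ?mulr1//.
  by rewrite normr_eq0.
have zN i : (i < N)%N -> coordinate i z = 0.
  by move=> iN; rewrite linearZ/= [coordinate i y]yN// mulr0.
(* Used for [s] equal to 1 and -1. *)
have key (s : K) : `|s| = 1 -> `|x + s *: z| <= 1.
  move=> s1; rewrite -[leLHS]/(c0_norm (val (x + s *: z))).
  have [i -> _] := c0_norm_attained (val (x + s *: z)).
  rewrite -[X in `|X|]/(coordinate i (x + s *: z)) linearD linearZ/=.
  rewrite (le_trans (ler_normD _ _))// normrM s1 mul1r.
  have [iN|Ni] := ltnP i N.
    rewrite zN// normr0 addr0 (le_trans _ x1)//; exact: c0_norm_ge.
  rewrite [leRHS](splitr 1) mul1r lerD//; first exact: xN.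
  by rewrite -nz; exact: c0_norm_ge.
split; first by have := key 1 (normr1 _); rewrite scale1r.
by have := key (-1) (normrN1 _); rewrite scaleN1r.
Qed.

End subspace_of_c0.

(** * The inclusion into the renormed space *)

Section day_inclusion.
Variables (R : realType) (K : numFieldType) (k : scalar_field R K).
Variable V : submodClosed (c0 K).

Definition day_inclusion (x : normed_subspace V) : day_space k := val x.

Lemma day_inclusion_is_linear : linear day_inclusion.
Proof. by move=> a x y; rewrite /day_inclusion linearP. Qed.

HB.instance Definition _ := GRing.isLinear.Build K (normed_subspace V)
  (day_space k) _ day_inclusion day_inclusion_is_linear.

Lemma day_inclusion_bounded : bounded_operator day_inclusion.
Proof. by exists 2 => x; rewrite mulr_natl; exact: day_space_norm_le. Qed.

(** The threshold 1 works because the inclusion does not decrease norms: on a nonzero [y] killed by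
    [S], the difference of the two operators has norm at least that of [y]. *)
Lemma day_inclusion_not_approximable
    (S : {linear normed_subspace V -> day_space k}) :
  infinite_dimensional (normed_subspace V) -> bounded_operator S ->
  norm_attaining S -> ~ operator_norm (day_inclusion \- S) < 1.
Proof.
move=> Vinf Sb [x x1 Sx] TS1.
have [|y y0 [xy1 xy2]] := no_extreme_point (x := x) Vinf; first by rewrite x1.
(* [S] attains its norm at [x], so [S x] and [S y] can play the roles of [z] and [w] in
   [day_norm_extreme]. *)
have ext v : `|v| <= 1 -> day_norm k (S v : c0 K) <= day_norm k (S x : c0 K).
  move=> v1; rewrite -(ler_emb k).
  by have := bounded_operator_normP k Sb v1; rewrite Sx.
have Sy : S y = 0.
  apply: (@day_norm_extreme _ _ k (S x)).
    by have := ext _ xy1; rewrite linearD.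
  by have := ext _ xy2; rewrite linearB.
have := operator_norm_ler k (bounded_operatorB day_inclusion_bounded Sb) y.
rewrite /= Sy subr0 => Ty.
have : `|y| < `|y|.
  have yle : `|y| <= `|day_inclusion y| := c0_norm_le_day_space (day_inclusion y).
  apply: le_lt_trans yle _.
  by rewrite (le_lt_trans Ty)// gtr_pMl ?normr_gt0.
by rewrite ltxx.
Qed.

Lemma not_lindenstrauss_A :
  infinite_dimensional (normed_subspace V) ->
  ~ lindenstrauss_A (normed_subspace V).
Proof.
move=> Vinf /(_ (day_space k) day_inclusion day_inclusion_bounded 1 ltr01).
by move=> [S [Sb Sna]]; exact: day_inclusion_not_approximable.
Qed.

End day_inclusion.

Theorem corollary2p16 (R : realType) (K : numFieldType)
    (hK : real_or_complex R K) (V : submodClosed (c0 K))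
    (Vclosed : closed [set x : c0 K | x \in V])
    (Vinf : infinite_dimensional (normed_subspace V)) :
  ~ lindenstrauss_A (normed_subspace V).
Proof.
case: hK V Vclosed Vinf => V _; apply: not_lindenstrauss_A.
  exact: real_scalars.
exact: complex_scalars.
Qed.
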